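(* Let $f_1,\dots,f_m:\mathbb{R}^n\to\mathbb{R}$ be continuously differentiable, and suppose that each $f_k$ ($1\le k\le m$) is $L$-smooth for some $L>0$. Suppose that for some $\alpha_0>0$ the function $$G_{\alpha_0}(\mathbf{x})=\alpha_0\sum_{k=1}^m f_k(x_k)+\frac12\,\mathbf{x}^T(I-W\otimes I_n)\mathbf{x},\qquad \mathbf{x}=(x_1,\dots,x_m)\in\mathbb{R}^{nm},$$ is strongly convex on $\mathbb{R}^{nm}$. Let $\{\alpha(t)\}_{t\ge 0}$ be a non-increasing sequence of positive stepsizes satisfying $$\alpha(0)\le\min\Big\{\frac{1+\lambda_m(W)}{L},\ \alpha_0\Big\}.$$ Then, for any initial states $x_1(0),\dots,x_m(0)\in\mathbb{R}^n$, the sequence generated by the decentralized gradient descent $$x_k(t+1)=\sum_{j=1}^m w_{kj}x_j(t)-\alpha(t)\nabla f_k(x_k(t)),\qquad 1\le k\le m,\ t\ge 0,$$ is uniformly bounded, i.e. there exists $R>0$ such that $\|x_k(t)\|\le R$ for all $t\ge 0$ and $1\le k\le m$.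
   Context: $W=\{w_{ij}\}_{1\le i,j\le m}$ is a real symmetric matrix with nonnegative entries associated with an undirected connected graph $\mathcal{G}=(\mathcal{V},\mathcal{E})$ on $\mathcal{V}=\{1,\dots,m\}$: for $i\neq j$, $w_{ij}>0$ if and only if $\{i,j\}\in\mathcal{E}$; $w_{ii}>0$ for all $i$; and $W$ is doubly stochastic ($W\mathbf{1}=\mathbf{1}$, $\mathbf{1}^TW=\mathbf{1}^T$). $\lambda_m(W)$ denotes the smallest eigenvalue of $W$. $I_n$ is the $n\times n$ identity, $I$ is the $nm\times nm$ identity, and $\mathbf{x}^T(I-W\otimes I_n)\mathbf{x}=\sum_{k}\|x_k\|^2-\sum_{k,j}w_{kj}x_k^Tx_j$. A differentiable function $g$ is $L$-smooth if $\|\nabla g(x)-\nabla g(y)\|\le L\|x-y\|$ for all $x,y$. A differentiable function $g$ is $\mu$-strongly convex ($\mu>0$) if $g(y)\ge g(x)+\langle\nabla g(x),y-x\rangle+\frac{\mu}{2}\|y-x\|^2$ for all $x,y$, and strongly convex if it is $\mu$-strongly convex for some $\mu>0$. *)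

(* Defs.v *)
From HB Require Import structures.
From mathcomp Require Import all_boot all_order all_algebra.
From mathcomp Require Import mxtens.
From mathcomp Require Import all_classical all_reals all_analysis.

Set Implicit Arguments.
Unset Strict Implicit.
Unset Printing Implicit Defensive.

Import Order.TTheory GRing.Theory Num.Theory.
Import numFieldNormedType.Exports.

Local Open Scope ring_scope.

(* Points of R^n are row vectors 'rV[R]_n.  The library norm `|x| on matrices
   is the sup norm, hence the explicit Euclidean structure below; the notions
   of differentiability and continuity do not depend on this choice. *)
Definition dotv (R : realType) (n : nat) (u v : 'rV[R]_n) : R :=
  \sum_(i < n) u 0 i * v 0 i.

Definition enorm (R : realType) (n : nat) (u : 'rV[R]_n) : R :=
  Num.sqrt (dotv u u).

Definition grad (R : realType) (n : nat) (f : 'rV[R]_n -> R) (x : 'rV[R]_n) :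
    'rV[R]_n :=
  \row_(i < n) 'D_(delta_mx 0 i) f x.

Definition continuously_differentiable (R : realType) (n : nat)
    (f : 'rV[R]_n -> R) : Prop :=
  (forall x, differentiable f x) /\ continuous (grad f).

Definition smooth (R : realType) (n : nat) (L : R) (g : 'rV[R]_n -> R) : Prop :=
  (forall x, differentiable g x) /\
  (forall x y, enorm (grad g x - grad g y) <= L * enorm (x - y)).

Definition strongly_convex_with (R : realType) (n : nat) (mu : R)
    (g : 'rV[R]_n -> R) : Prop :=
  (forall x, differentiable g x) /\
  (forall x y,
     g x + dotv (grad g x) (y - x) + mu / 2 * enorm (y - x) ^+ 2 <= g y).

Definition strongly_convex (R : realType) (n : nat) (g : 'rV[R]_n -> R) : Prop :=
  exists2 mu : R, 0 < mu & strongly_convex_with mu g.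

Record connected_graph (m : nat) (E : rel 'I_m) : Prop := ConnectedGraph {
  graph_sym : symmetric E;
  graph_irr : irreflexive E;
  graph_connected : forall i j, connect E i j }.

Record mixing_matrix (R : realType) (m : nat) (E : rel 'I_m) (W : 'M[R]_m) :
    Prop := MixingMatrix {
  mixing_sym : W^T = W;
  mixing_ge0 : forall i j, 0 <= W i j;
  mixing_edge : forall i j, i != j -> (0 < W i j <-> E i j);
  mixing_diag : forall i, 0 < W i i;
  mixing_row : W *m const_mx 1 = const_mx 1 :> 'cV[R]_m;
  mixing_col : const_mx 1 *m W = const_mx 1 :> 'rV[R]_m }.

(* [W] is meant to be symmetric, so that all its eigenvalues are real. *)
Definition smallest_eigenvalue (R : realType) (m : nat) (W : 'M[R]_m) (lam : R) :
    Prop :=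
  eigenvalue W lam /\ (forall a : R, eigenvalue W a -> lam <= a).

(* The block x_k of x = (x_1, ..., x_m) in R^(m * n); [mxtens_index] is the
   index bijection underlying the Kronecker product [*t]. *)
Definition block (R : realType) (m n : nat) (x : 'rV[R]_(m * n)) (k : 'I_m) :
    'rV[R]_n :=
  \row_(i < n) x 0 (mxtens_index (k, i)).

(* x is a row vector, so the quadratic form x^T A x of a column vector becomes
   x A x^T. *)
Definition penalized_cost (R : realType) (m n : nat) (W : 'M[R]_m)
    (f : 'I_m -> 'rV[R]_n -> R) (a : R) (x : 'rV[R]_(m * n)) : R :=
  a * (\sum_(k < m) f k (block x k)) +
  2^-1 * (x *m (1%:M - W *t (1%:M : 'M[R]_n)) *m x^T) 0 0.

Definition decentralized_gradient_descent (R : realType) (m n : nat)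
    (W : 'M[R]_m) (f : 'I_m -> 'rV[R]_n -> R) (alpha : nat -> R)
    (x : nat -> 'I_m -> 'rV[R]_n) : Prop :=
  forall t k,
    x t.+1 k = \sum_(j < m) W k j *: x t j - alpha t *: grad (f k) (x t k).

(* Main.v *)
(* One step of the algorithm is the unit gradient step x - grad G_a(x), where
   a = alpha(t).  By the descent lemma for the f_k and the Rayleigh bound
   lam_m |v|^2 <= v (W *t 1) v^T, the gradient of G_a has smoothness constant
   l = a L + 1 - lam_m <= 2, and G_a is (a / alpha0) mu-strongly convex as a
   convex combination of G_alpha0 and the penalty term.
   If alpha(t) = (1 + lam_m) / L for all t, then l = 2, the fixed function G_a
   does not increase along the iterates, and its sublevel sets are bounded.
   Otherwise l stays below some l' < 2 from some time on, and cocoercivity of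
   grad G_a gives |x - (grad G_a(x) - grad G_a(0))|^2 <= (1 - c a) |x|^2 with c
   independent of t.  Since grad G_a(0) = a grad F(0) is also of order a, every
   ball of radius at least 2 |grad F(0)| / c is then preserved. *)
Require Import Defs.
From HB Require Import structures.
From mathcomp Require Import all_boot all_order all_algebra.
From mathcomp Require Import mxtens ring lra.
From mathcomp Require Import all_classical all_reals all_analysis.

Import Order.TTheory GRing.Theory Num.Theory.
Import numFieldNormedType.Exports.

Local Open Scope ring_scope.

(** * The Euclidean inner product on row vectors *)

Lemma dotvC {R : realType} {n} (u v : 'rV[R]_n) : dotv u v = dotv v u.
Proof. by apply: eq_bigr => i _; rewrite mulrC. Qed.

Lemma dotvDl {R : realType} {n} (u v w : 'rV[R]_n) :
  dotv (u + v) w = dotv u w + dotv v w.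
Proof. by rewrite -big_split; apply: eq_bigr => i _; rewrite mxE mulrDl. Qed.

Lemma dotvZl {R : realType} {n} a (u v : 'rV[R]_n) :
  dotv (a *: u) v = a * dotv u v.
Proof. by rewrite mulr_sumr; apply: eq_bigr => i _; rewrite mxE mulrA. Qed.

Lemma dotvNl {R : realType} {n} (u v : 'rV[R]_n) : dotv (- u) v = - dotv u v.
Proof. by rewrite -scaleN1r dotvZl mulN1r. Qed.

Lemma dotvDr {R : realType} {n} (u v w : 'rV[R]_n) :
  dotv u (v + w) = dotv u v + dotv u w.
Proof. by rewrite dotvC dotvDl !(dotvC u). Qed.

Lemma dotvZr {R : realType} {n} a (u v : 'rV[R]_n) :
  dotv u (a *: v) = a * dotv u v.
Proof. by rewrite dotvC dotvZl dotvC. Qed.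

Lemma dotvNr {R : realType} {n} (u v : 'rV[R]_n) : dotv u (- v) = - dotv u v.
Proof. by rewrite dotvC dotvNl dotvC. Qed.

Definition dotvE := (@dotvDl, @dotvDr, @dotvNl, @dotvNr, @dotvZl, @dotvZr).

Lemma dotv0l {R : realType} {n} (v : 'rV[R]_n) : dotv 0 v = 0.
Proof. by rewrite -(scale0r 0) dotvZl mul0r. Qed.

Lemma dotvv_ge0 {R : realType} {n} (u : 'rV[R]_n) : 0 <= dotv u u.
Proof. by apply: sumr_ge0 => i _; rewrite -expr2 sqr_ge0. Qed.

Lemma dotvv_eq0 {R : realType} {n} (u : 'rV[R]_n) : (dotv u u == 0) = (u == 0).
Proof.
apply/eqP/eqP => [/eqP|->]; last exact: dotv0l.
rewrite psumr_eq0 => [/allP u0|i _]; last by rewrite -expr2 sqr_ge0.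
apply/rowP => i; rewrite mxE; apply/eqP.
by have := u0 i (mem_index_enum i); rewrite mulf_eq0 orbb.
Qed.

Lemma dotv_mulmx {R : realType} {n} (A : 'M[R]_n) (u v : 'rV[R]_n) :
  dotv (u *m A) v = (u *m A *m v^T) 0 0.
Proof. by rewrite [RHS]mxE; apply: eq_bigr => i _; rewrite !mxE. Qed.

Lemma dotv_mulmx_sym {R : realType} {n} (A : 'M[R]_n) (u v : 'rV[R]_n) :
  A^T = A -> dotv (u *m A) v = dotv (v *m A) u.
Proof.
move=> sA; have T (M : 'M[R]_1) : M 0 0 = M^T 0 0 by rewrite mxE.
by rewrite !dotv_mulmx [RHS]T !trmx_mul trmxK sA mulmxA.
Qed.

(** * Cauchy-Schwarz inequalities and the Euclidean norm *)

Lemma binary_form_discr (R : realType) (a b c : R) :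
  (forall s r, 0 <= a * s ^+ 2 + b * s * r *+ 2 + c * r ^+ 2) ->
  b ^+ 2 <= a * c.
Proof.
move=> H; have c0 : 0 <= c by have := H 0 1; nra.
case: (eqVneq c 0) => [c00|cn0]; last first.
  (* At [(c, - b)] the form equals [c * (a * c - b ^+ 2)], and [c] can be cancelled. *)
  have := H c (- b); have : 0 < c by rewrite lt_def cn0.
  nra.
(* For [c = 0] this point gives the value [-4 b^2], which forces [b = 0]. *)
have := H (b *+ 2) (- (a + 1)); rewrite c00.
by have := sqr_ge0 b; nra.
Qed.

(** Evaluating the form on combinations of [u] and [v] gives a nonnegative binary form.
    Semidefiniteness is the right generality: the Rayleigh bound applies this to a singular
    matrix. *)
Lemma psd_cauchy_schwarz {R : realType} {n} (A : 'M[R]_n) (u v : 'rV[R]_n) :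
  A^T = A -> (forall w, 0 <= dotv (w *m A) w) ->
  dotv (u *m A) v ^+ 2 <= dotv (u *m A) u * dotv (v *m A) v.
Proof.
move=> sA psdA; apply: binary_form_discr => s r.
have := psdA (s *: u + r *: v).
rewrite mulmxDl -!scalemxAl !dotvE (@dotv_mulmx_sym _ _ A v u) //.
by congr (0 <= _); ring.
Qed.

Lemma dotv_cauchy_schwarz {R : realType} {n} (u v : 'rV[R]_n) :
  dotv u v ^+ 2 <= dotv u u * dotv v v.
Proof.
have := @psd_cauchy_schwarz R n 1%:M u v (trmx1 _ _); rewrite !mulmx1; apply.
by move=> w; rewrite mulmx1 dotvv_ge0.
Qed.

Lemma enorm_ge0 {R : realType} {n} (u : 'rV[R]_n) : 0 <= enorm u.
Proof. exact: sqrtr_ge0. Qed.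

Lemma enorm_sqr {R : realType} {n} (u : 'rV[R]_n) : enorm u ^+ 2 = dotv u u.
Proof. by rewrite sqr_sqrtr // dotvv_ge0. Qed.

Lemma ler_dotv {R : realType} {n} (u v : 'rV[R]_n) :
  dotv u v <= enorm u * enorm v.
Proof.
rewrite (le_trans (ler_norm _))// -sqrtrM ?dotvv_ge0// -sqrtr_sqr.
by rewrite ler_wsqrtr // dotv_cauchy_schwarz.
Qed.

Lemma ler_enormP {R : realType} {n} (u : 'rV[R]_n) (B : R) :
  0 <= B -> (enorm u <= B) = (dotv u u <= B ^+ 2).
Proof. by move=> B0; rewrite -enorm_sqr ler_sqr // nnegrE enorm_ge0. Qed.

Lemma ler_enormD {R : realType} {n} (u v : 'rV[R]_n) :
  enorm (u + v) <= enorm u + enorm v.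
Proof.
rewrite ler_enormP ?addr_ge0 ?enorm_ge0// !dotvE (dotvC v u) sqrrD !enorm_sqr.
by have := ler_dotv u v; lra.
Qed.

Lemma enormZ {R : realType} {n} (a : R) (u : 'rV[R]_n) :
  enorm (a *: u) = `|a| * enorm u.
Proof. by rewrite /enorm !dotvE mulrA -expr2 sqrtrM ?sqr_ge0 // sqrtr_sqr. Qed.

(** * Derivatives along lines and the descent lemma *)

(** Both sides have the same difference quotient, so one-variable calculus applies to directional
    derivatives. *)
Lemma is_derive_line {R : realType} {n} (f : 'rV[R]_n -> R) (x v : 'rV[R]_n)
    (s df : R) :
  is_derive (x + s *: v) v f df <->
  is_derive s 1 (fun r : R => f (x + r *: v)) df.
Proof.
have E : (fun h : R =>
    h^-1 *: ((f \o shift (x + s *: v)) (h *: v) - f (x + s *: v))) =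
  (fun h : R => h^-1 *: (((fun r : R => f (x + r *: v)) \o shift s) (h *: 1)
                         - f (x + s *: v))).
  apply/funext => h /=; congr (_ *: (f _ - _)).
  by rewrite scalerDl addrCA [h *: 1]mulr1.
split=> -[d1 d2]; split.
- by move: d1; rewrite /derivable E.
- by move: d2; rewrite /derive E.
- by move: d1; rewrite /derivable E.
- by move: d2; rewrite /derive E.
Qed.

Lemma derive_dotv_grad {R : realType} {n} (f : 'rV[R]_n -> R) (x v : 'rV[R]_n) :
  differentiable f x -> 'D_v f x = dotv (grad f x) v.
Proof.
move=> df; rewrite deriveE // {1}(row_sum_delta v) linear_sum.
by apply: eq_bigr => i _; rewrite linearZ /= mxE deriveE // mulrC.
Qed.

(** The mean value theorem replaces integration: along the segment, [f] minus its quadratic model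
    has derivative at most 0, by Cauchy-Schwarz and the Lipschitz bound on the gradient. *)
Lemma smooth_upper {R : realType} {n} (L : R) (f : 'rV[R]_n -> R) :
  smooth L f -> forall x y,
  f y <= f x + dotv (grad f x) (y - x) + L / 2 * dotv (y - x) (y - x).
Proof.
move=> [df Lf] x y; set v := y - x; set g := grad f x.
have fline (s : R) : is_derive s 1 (fun r : R => f (x + r *: v))
    (dotv (grad f (x + s *: v)) v).
  apply/is_derive_line; rewrite -derive_dotv_grad //.
  by apply: derivableP; apply: diff_derivable.
pose h (r : R) := f (x + r *: v) - (r * dotv g v + r ^+ 2 * (L / 2 * dotv v v)).
pose dh (s : R) := dotv (grad f (x + s *: v)) v - (dotv g v + s * L * dotv v v).
have hd (s : R) : is_derive s 1 h (dh s).
  rewrite /h /dh; apply: is_derive_eq.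
  rewrite !scaler0 !add0r /= /GRing.scale /=; lra.
have hc : {within `[0, 1], continuous h}%classic.
  apply: derivable_within_continuous => s _; exact: @ex_derive _ _ _ _ _ _ _ (hd s).
have [s s01 E] := MVT_segment ler01 (fun s _ => hd s) hc.
suff : h 1 <= h 0.
  rewrite /h !scale1r !scale0r addr0 {1}/v [x + _]addrC subrK; lra.
rewrite -subr_le0 E subr0 mulr1 /dh -/g.
have s0 : 0 <= s by move: s01; rewrite in_itv => /andP[].
have := ler_dotv (grad f (x + s *: v) - g) v.
have := ler_wpM2r (enorm_ge0 v) (Lf (x + s *: v) x).
rewrite [x + _ - _]addrC addKr enormZ ger0_norm // -/g -[dotv v v]enorm_sqr !dotvE.
by nra.
Qed.

(** * The Rayleigh bound for symmetric matrices *)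

Lemma continuous_dotv_mulmx {R : realType} {n} (A : 'M[R]_n) :
  continuous (fun u : 'rV[R]_n => dotv (u *m A) u).
Proof.
have -> : (fun u : 'rV[R]_n => dotv (u *m A) u) =
    \sum_(i < n) \sum_(j < n) (fun u : 'rV[R]_n => u 0 j * A j i * u 0 i).
  apply/funext => u; rewrite fct_sumE; apply: eq_bigr => i _.
  by rewrite fct_sumE mxE mulr_suml.
have cD (g h : 'rV[R]_n -> R) : continuous g -> continuous h -> continuous (g + h).
  by move=> cg ch u; apply: continuousD; [exact: cg|exact: ch].
have c0 : continuous (0 : 'rV[R]_n -> R) by exact: cst_continuous.
apply: (big_ind (fun g : 'rV[R]_n -> R => continuous g)) => // i _.
apply: (big_ind (fun g : 'rV[R]_n -> R => continuous g)) => // j _ u.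
apply: (@continuousM _ _ (fun u : 'rV[R]_n => u 0 j * A j i) (fun u => u 0 i));
  last exact: coord_continuous.
apply: (@continuousM _ _ (fun u : 'rV[R]_n => u 0 j) (cst (A j i))).
  exact: coord_continuous.
exact: cst_continuous.
Qed.

Lemma compact_unit_sphere (R : realType) (n : nat) :
  compact [set u : 'rV[R]_n | dotv u u = 1]%classic.
Proof.
apply: bounded_closed_compact.
  exists 1; split => // M M1 u /= u1; apply: le_trans (ltW M1).
  (* Boundedness refers to the sup norm: each squared coordinate is at most [dotv u u]. *)
  rewrite /Num.norm /= mx_normrE; apply: bigmax_le => // -[i j] _ /=.
  rewrite (ord1 i) -(@ler_pXn2r _ 2) ?nnegrE // expr1n -u1 real_normK ?num_real //.
  rewrite /dotv (bigD1 j) //= expr2 lerDl.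
  by apply: sumr_ge0 => k _; rewrite -expr2 sqr_ge0.
have -> : [set u : 'rV[R]_n | dotv u u = 1]%classic =
    ((fun u : 'rV[R]_n => dotv (u *m 1%:M) u) @^-1` [set x | x = 1])%classic.
  by apply/seteqP; split => u /=; rewrite mulmx1.
apply: preimage_closed; last exact: closed_eq.
by move=> u _; apply: continuous_dotv_mulmx.
Qed.

(** The quadratic form attains a minimum [rho] on the unit sphere, at some [c]. Then [A - rho%:M] is
    positive semidefinite and its form vanishes at [c], so [c] lies in its kernel; hence [rho] is an
    eigenvalue and [lam <= rho]. *)
Lemma rayleigh_ge {R : realType} {n} (A : 'M[R]_n) (lam : R) :
  A^T = A -> (forall a, eigenvalue A a -> lam <= a) ->
  forall u : 'rV[R]_n, lam * dotv u u <= dotv (u *m A) u.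
Proof.
move=> sA minlam u; have [->|u0] := eqVneq u 0.
  by rewrite mul0mx dotv0l mulr0.
pose S := [set u : 'rV[R]_n | dotv u u = 1]%classic.
have norm_sphere (v : 'rV[R]_n) : v != 0 -> S ((enorm v)^-1 *: v).
  move=> v0; rewrite /S /= !dotvE -enorm_sqr.
  by field; rewrite sqrtr_eq0 -ltNge lt_def dotvv_eq0 v0 dotvv_ge0.
have [c /set_mem Sc cmin] : exists2 c, c \in S & forall t, t \in S ->
    dotv (c *m A) c <= dotv (t *m A) t.
  apply: EVT_min_rV; last exact/continuous_subspaceT/continuous_dotv_mulmx.
  - by exists ((enorm u)^-1 *: u); exact: norm_sphere.
  - exact: compact_unit_sphere.
set rho := dotv (c *m A) c in cmin.
have rayleigh (v : 'rV[R]_n) : rho * dotv v v <= dotv (v *m A) v.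
  have [->|v0] := eqVneq v 0; first by rewrite mul0mx dotv0l mulr0.
  have := cmin _ (mem_set (norm_sphere v v0)).
  rewrite -scalemxAl !dotvE mulrA -invfM -expr2 enorm_sqr mulrC.
  by rewrite ler_pdivlMr // lt_def dotvv_eq0 v0 dotvv_ge0.
suff rhoeig : eigenvalue A rho.
  by apply: le_trans (rayleigh u); rewrite ler_wpM2r ?dotvv_ge0 ?minlam.
apply/eigenvalueP; exists c; last first.
  by rewrite -dotvv_eq0 (Sc : dotv c c = 1) oner_eq0.
set B := A - rho%:M.
have BE (v : 'rV[R]_n) : v *m B = v *m A - rho *: v.
  by rewrite mulmxBr mul_mx_scalar.
have sB : B^T = B by rewrite /B linearB /= sA tr_scalar_mx.
have psdB v : 0 <= dotv (v *m B) v.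
  by rewrite BE !dotvE subr_ge0 rayleigh.
have cB : dotv (c *m B) c = 0.
  by rewrite BE !dotvE (Sc : dotv c c = 1) mulr1 subrr.
(* Testing against [c *m B] itself bounds the fourth power of its norm by 0. *)
have := psd_cauchy_schwarz B c (c *m B) sB psdB.
rewrite cB mul0r => le0; apply/eqP; rewrite -subr_eq0 -BE -dotvv_eq0.
by rewrite -sqrf_eq0 eq_le le0 sqr_ge0.
Qed.

(** * Gradient steps on smooth convex functions *)

(* Baillon-Haddad. *)
Lemma gradient_cocoercive {R : realType} {n} (G : 'rV[R]_n -> R)
    (g : 'rV[R]_n -> 'rV[R]_n) (l : R) :
  0 < l ->
  (forall x y, G x + dotv (g x) (y - x) <= G y) ->
  (forall x y,
     G y <= G x + dotv (g x) (y - x) + l / 2 * dotv (y - x) (y - x)) ->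
  forall x y, dotv (g x - g y) (g x - g y) <= l * dotv (g x - g y) (x - y).
Proof.
move=> l0 conv up x y.
have half u v : dotv (g u - g v) (g u - g v) / l / 2 <=
    G u - G v - dotv (g v) (u - v).
  (* [z] minimizes the quadratic upper model at [u] of [G] minus the linear form of [g v]. The upper
     bound from [u] and the convexity bound from [v] are compared there. *)
  set d := g u - g v; set z := u - l^-1 *: d.
  have dd : dotv d d = dotv (g u) d - dotv (g v) d by rewrite {1}/d !dotvE.
  have zu : z - u = - (l^-1 *: d) by rewrite /z addrC addKr.
  have zv : z - v = (u - v) - l^-1 *: d by rewrite /z addrAC.
  have := conv v z; have := up u z.
  rewrite zu zv; move: (u - v) => w; clearbody d z; rewrite !dotvE opprK.
  have -> : l / 2 * (l^-1 * (l^-1 * dotv d d)) = dotv d d / l / 2.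
    by field; rewrite lt0r_neq0.
  have -> : dotv d d / l = l^-1 * dotv (g u) d - l^-1 * dotv (g v) d.
    by rewrite dd mulrC mulrBr.
  by lra.
(* Adding the two symmetric inequalities cancels the values of [G]. *)
have := lerD (half x y) (half y x).
rewrite -[y - x]opprB -[g y - g x]opprB.
rewrite -ler_pdivrMl // mulrC (dotvDl _ _ (x - y)).
by rewrite !dotvNl !dotvNr !opprK; lra.
Qed.

(** With [d = g x - g 0], cocoercivity bounds [|x - d|^2] by [|x|^2 - (2 - l) <d, x>], and strong
    monotonicity gives [<d, x> >= mu |x|^2]. The reference point is 0, not the minimizer, because
    the latter moves with the stepsize. *)
Lemma gradient_step_contraction {R : realType} {n} (G : 'rV[R]_n -> R)
    (g : 'rV[R]_n -> 'rV[R]_n) (mu l : R) :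
  0 <= mu -> 0 < l -> l <= 2 ->
  (forall x y,
     G x + dotv (g x) (y - x) + mu / 2 * dotv (y - x) (y - x) <= G y) ->
  (forall x y,
     G y <= G x + dotv (g x) (y - x) + l / 2 * dotv (y - x) (y - x)) ->
  forall x, dotv (x - (g x - g 0)) (x - (g x - g 0)) <=
            (1 - (2 - l) * mu) * dotv x x.
Proof.
move=> mu0 l0 l2 sconv up x.
have conv u v : G u + dotv (g u) (v - u) <= G v.
  apply: le_trans (sconv u v); rewrite lerDl.
  by rewrite mulr_ge0 ?dotvv_ge0 // divr_ge0.
have := gradient_cocoercive G g l l0 conv up x 0.
have := lerD (sconv x 0) (sconv 0 x); rewrite subr0 sub0r.
set d := g x - g 0 => H1 H2.
have H3 : mu * dotv x x <= dotv d x.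
  by move: H1; rewrite /d !dotvE; lra.
clearbody d; rewrite !dotvE (dotvC x d).
have := ler_wpM2l (_ : 0 <= 2 - l) H3; rewrite subr_ge0 => /(_ l2).
by lra.
Qed.

(** * Quadratic expansion, bounded tails and bounded sublevel sets *)

Lemma quadratic_expansion {R : realType} {n} (A : 'M[R]_n) (x y : 'rV[R]_n) :
  A^T = A ->
  dotv (y *m A) y = dotv (x *m A) x + 2 * dotv (x *m A) (y - x) +
                    dotv ((y - x) *m A) (y - x).
Proof.
move=> sA; rewrite mulmxBl !dotvE (dotv_mulmx_sym A y x sA); lra.
Qed.

Lemma bounded_of_tail {R : realType} (u : nat -> R) (t0 : nat) (B : R) :
  (forall t, (t0 <= t)%N -> u t <= B) ->
  exists2 B' : R, 0 < B' & forall t, u t <= B'.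
Proof.
elim: t0 B => [|t0 IH] B uB.
  exists (Num.max B 1) => [|t]; first by rewrite lt_max ltr01 orbT.
  by rewrite le_max uB.
apply: (IH (Num.max B (u t0))) => t; rewrite leq_eqVlt => /orP[/eqP <-|t0t].
  by rewrite le_max lexx orbT.
by rewrite le_max uB.
Qed.

(** Far from 0 the term [mu / 2 |x|^2] dominates both the linear term and the constant [c - G 0]. *)
Lemma strongly_convex_sublevel_bounded {R : realType} {n} (G : 'rV[R]_n -> R)
    (g : 'rV[R]_n) (mu c : R) :
  0 < mu ->
  (forall x, G 0 + dotv g x + mu / 2 * dotv x x <= G x) ->
  exists B, forall x, G x <= c -> enorm x <= B.
Proof.
move=> mu0 sconv; set K := enorm g + `|c - G 0|.
have K0 : 0 <= K by rewrite addr_ge0 ?enorm_ge0.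
(* The summand 1 ensures [|x| >= 1] outside the ball, so the constant is absorbed into a multiple of
   [|x|]. *)
exists (1 + 2 * K / mu) => x Gx; rewrite leNgt; apply/negP => xB.
have KB0 : 0 <= 2 * K / mu by rewrite divr_ge0 ?mulr_ge0 // ltW.
have x1 : 1 <= enorm x by lra.
have xK : K < mu / 2 * enorm x.
  have : 2 * K / mu < enorm x by lra.
  by rewrite ltr_pdivrMr //; lra.
have := sconv x; rewrite -enorm_sqr.
have := ler_dotv (- g) x; rewrite -(scaleN1r g) enormZ normrN1 mul1r dotvZl.
have := ler_norm (c - G 0); have := normr_ge0 (c - G 0).
move: (erefl K); rewrite {2}/K; clearbody K => KE.
set z := `|c - G 0| in KE *; set e := enorm x in x1 xK *.
have : K * e < mu / 2 * e * e by rewrite ltr_pM2r //; lra.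
have : z <= z * e by rewrite ler_peMr // normr_ge0.
rewrite KE mulrDl; lra.
Qed.

(** * Unit gradient steps on a smooth function with a quadratic penalty *)

Section PenalizedDescent.
Variables (R : realType) (N : nat).
Variables (F : 'rV[R]_N -> R) (gF : 'rV[R]_N -> 'rV[R]_N) (A : 'M[R]_N).
Variables (L lam mu alpha0 : R).
Hypothesis symA : A^T = A.
Hypothesis psdA : forall v, 0 <= dotv (v *m A) v.
Hypothesis ubA : forall v, dotv (v *m A) v <= (1 - lam) * dotv v v.
Hypothesis upF : forall x y,
  F y <= F x + dotv (gF x) (y - x) + L / 2 * dotv (y - x) (y - x).
Hypothesis L0 : 0 < L.
Hypothesis mu0 : 0 < mu.
Hypothesis alpha00 : 0 < alpha0.

Let G a x := a * F x + 2^-1 * dotv (x *m A) x.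
Let g a x := a *: gF x + x *m A.

Hypothesis sconvG : forall x y,
  G alpha0 x + dotv (g alpha0 x) (y - x) + mu / 2 * dotv (y - x) (y - x)
  <= G alpha0 y.

(** The constants add: [a * L] comes from [upF] and [1 - lam] from the exact expansion of the
    penalty with [ubA]. *)
Lemma penalized_upper a x y : 0 <= a ->
  G a y <= G a x + dotv (g a x) (y - x)
           + (a * L + 1 - lam) / 2 * dotv (y - x) (y - x).
Proof.
move=> a0; rewrite /G /g (dotvDl (a *: _)) dotvZl (quadratic_expansion A x y symA).
have := ler_wpM2l a0 (upF x y); have := ubA (y - x).
set d := dotv (y - x) (y - x); nra.
Qed.

(* [G a] is a convex combination of [G alpha0] and the penalty term. *)
Lemma penalized_strongly_convex a x y : 0 <= a -> a <= alpha0 ->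
  G a x + dotv (g a x) (y - x) + (mu * (a / alpha0)) / 2 * dotv (y - x) (y - x)
  <= G a y.
Proof.
move=> a0 aa0; set th := a / alpha0.
have th0 : 0 <= th by rewrite divr_ge0 // ltW.
have th1 : th <= 1 by rewrite ler_pdivrMr ?mul1r.
have -> : a = th * alpha0 by rewrite divfK // lt0r_neq0.
have := ler_wpM2l th0 (sconvG x y).
have : 0 <= (1 - th) * dotv ((y - x) *m A) (y - x).
  by rewrite mulr_ge0 ?subr_ge0.
rewrite /G /g !(dotvDl (_ *: _)) !dotvZl (quadratic_expansion A x y symA).
set d := dotv (y - x) (y - x); set q := dotv ((y - x) *m A) _.
lra.
Qed.

Variables (alpha : nat -> R) (x : nat -> 'rV[R]_N).
Hypothesis alpha_gt0 : forall t, 0 < alpha t.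
Hypothesis alpha_noninc : forall s t, (s <= t)%N -> alpha t <= alpha s.
Hypothesis alpha_le0 : alpha 0%N <= alpha0.
Hypothesis alpha_leL : alpha 0%N <= (1 + lam) / L.
Hypothesis xS : forall t, x t.+1 = x t - g (alpha t) (x t).

Let alpha_le t : alpha t <= alpha0.
Proof. by apply: le_trans alpha_le0; exact: alpha_noninc. Qed.

(* With smoothness constant 2, unit steps do not increase [G a]. *)
Lemma bounded_constant_stepsize a : (forall t, alpha t = a) ->
  a * L + 1 - lam <= 2 -> exists B, forall t, enorm (x t) <= B.
Proof.
move=> alphaE al2.
have a0 : 0 < a by rewrite -(alphaE 0%N).
have aa0 : a <= alpha0 by rewrite -(alphaE 0%N).
have sc0 y : G a 0 + dotv (g a 0) y + (mu * (a / alpha0)) / 2 * dotv y y <= G a y.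
  by have := penalized_strongly_convex a 0 y (ltW a0) aa0; rewrite subr0.
have [|B GB] := strongly_convex_sublevel_bounded (G a) (g a 0) _ (G a (x 0%N)) _ sc0.
  by rewrite mulr_gt0 // divr_gt0.
exists B => t; apply: GB; elim: t => // t; apply: le_trans.
(* For the step [- w] with [w = g a (x t)], the change is at most [(l / 2 - 1) |w|^2 <= 0], where
   [l = a * L + 1 - lam]. *)
have := penalized_upper a (x t) (x t.+1) (ltW a0).
rewrite xS alphaE [x t - _ - _]addrC addKr.
move: (g a (x t)) (dotvv_ge0 (g a (x t))) => w w0.
by rewrite !dotvE opprK; nra.
Qed.

(** The ball of radius [M] is invariant from [t0] on: one step yields at most
    [(1 - c a / 2) M + a D], and [2 D <= c M]. *)
Lemma bounded_small_stepsize t0 : alpha t0 < (1 + lam) / L ->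
  exists B, forall t, (t0 <= t)%N -> enorm (x t) <= B.
Proof.
move=> t0L.
(* The maximum with 1 keeps [l] positive, as cocoercivity requires. *)
set l := Num.max 1 (alpha t0 * L + 1 - lam).
have l2 : l < 2.
  rewrite gt_max; apply/andP; split; first lra.
  by move: t0L; rewrite ltr_pdivlMr //; lra.
have l1 : 1 <= l by rewrite le_max lexx.
(* The first entry is the contraction rate per unit of stepsize; the second gives [c * a <= 1], so
   that [1 - c * a] is nonnegative. *)
set c := Num.min ((2 - l) * mu / alpha0) alpha0^-1.
have c0 : 0 < c.
  rewrite lt_min invr_gt0 alpha00 andbT divr_gt0 // mulr_gt0 //; lra.
set D := enorm (gF 0).
(* The first entry starts the induction at [t0]; the second absorbs the drift [a * D]. *)
set M := Num.max (enorm (x t0)) (2 * D / c).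
have M0 : 0 <= M by rewrite le_max enorm_ge0.
exists M => t; elim: t => [|t IH].
  by rewrite leqn0 => /eqP <-; rewrite le_max lexx.
rewrite leq_eqVlt => /orP[/eqP <-|]; first by rewrite le_max lexx.
rewrite ltnS => t0t; have {IH} xM := IH t0t.
set a := alpha t; have a0 : 0 < a by exact: alpha_gt0.
have aa0 : a <= alpha0 by exact: alpha_le.
have up u v : G a v <= G a u + dotv (g a u) (v - u) + l / 2 * dotv (v - u) (v - u).
  apply: le_trans (penalized_upper a u v (ltW a0)) _; rewrite lerD2l.
  rewrite ler_wpM2r ?dotvv_ge0 // ler_pM2r // le_max; apply/orP; right.
  by rewrite lerB // lerD2r ler_pM2r // alpha_noninc.
have mua : 0 <= mu * (a / alpha0) by rewrite mulr_ge0 ?divr_ge0 // ltW.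
have := gradient_step_contraction (G a) (g a) _ l mua (lt_le_trans ltr01 l1)
  (ltW l2) (fun u v => penalized_strongly_convex a u v (ltW a0) aa0) up (x t).
have g0 : g a 0 = a *: gF 0 by rewrite /g mul0mx addr0.
set w := x t - _ => wle.
have ca1 : c * a <= 1.
  rewrite -(@divff _ alpha0) ?lt0r_neq0 // [_ / _]mulrC.
  by apply: ler_pM; rewrite ?(ltW c0) ?(ltW a0) // ge_min lexx orbT.
have cle : c * a <= (2 - l) * (mu * (a / alpha0)).
  have -> : (2 - l) * (mu * (a / alpha0)) = (2 - l) * mu / alpha0 * a.
    by field; rewrite lt0r_neq0.
  by rewrite ler_pM2r // ge_min lexx.
(* This uses [1 - c a <= (1 - c a / 2)^2], so the rate becomes linear in [a] after taking roots. *)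
have wM : enorm w <= (1 - c * a / 2) * M.
  rewrite ler_enormP; last by rewrite mulr_ge0 //; lra.
  apply: (le_trans wle); apply: (@le_trans _ _ ((1 - c * a) * dotv (x t) (x t))).
    by rewrite ler_wpM2r ?dotvv_ge0 // lerB.
  have xxM : dotv (x t) (x t) <= M ^+ 2 by rewrite -ler_enormP.
  apply: (@le_trans _ _ ((1 - c * a) * M ^+ 2)).
    by rewrite ler_wpM2l // subr_ge0.
  rewrite exprMn ler_wpM2r ?sqr_ge0 //.
  by have := sqr_ge0 (c * a); lra.
have -> : x t.+1 = w + (- a) *: gF 0.
  by rewrite xS -/a /w g0 opprB scaleNr addrA addrAC addrK.
apply: le_trans (ler_enormD _ _) _.
rewrite enormZ normrN gtr0_norm // -/D.
have DM : 2 * D <= c * M by rewrite [c * M]mulrC -ler_pdivrMr // le_max lexx orbT.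
have := ler_wpM2l (ltW a0) DM; lra.
Qed.

Lemma bounded_penalized_descent :
  exists2 B : R, 0 < B & forall t, enorm (x t) <= B.
Proof.
have [[t0 t0L]|large] := pselect (exists t, alpha t < (1 + lam) / L).
  have [B xB] := bounded_small_stepsize t0 t0L.
  exact: bounded_of_tail xB.
(* No stepsize lies below [(1 + lam) / L], while monotonicity keeps all of them at most that
   value. *)
have alphaE t : alpha t = (1 + lam) / L.
  apply/eqP; rewrite eq_le leNgt; apply/andP; split.
    by rewrite -leNgt (le_trans _ alpha_leL) // alpha_noninc.
  by rewrite leNgt; apply/negP => ?; apply: large; exists t.
have [|B xB] := bounded_constant_stepsize _ alphaE.
  by rewrite divfK ?lt0r_neq0 //; lra.
exact: (bounded_of_tail _ 0%N B).
Qed.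

End PenalizedDescent.

(** * Derivatives of quadratic forms *)

Lemma is_derive_line0 {R : realType} {n} (f : 'rV[R]_n -> R) (x v : 'rV[R]_n)
    (df : R) :
  is_derive x v f df <->
  is_derive (0 : R) (1 : R) (fun r : R => f (x + r *: v)) df.
Proof. by have := is_derive_line f x v 0 df; rewrite scale0r addr0. Qed.

Lemma is_derive_quadratic {R : realType} {n} (A : 'M[R]_n) (x v : 'rV[R]_n) :
  A^T = A ->
  is_derive x v (fun u => dotv (u *m A) u) (2 * dotv (x *m A) v).
Proof.
move=> sA; apply/is_derive_line0.
have -> : (fun r : R => dotv ((x + r *: v) *m A) (x + r *: v)) =
    (fun r : R => dotv (x *m A) x + r * (2 * dotv (x *m A) v)
                  + r ^+ 2 * dotv (v *m A) v).
  apply/funext => r.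
  rewrite (quadratic_expansion A x (x + r *: v) sA) [x + _ - _]addrC addKr.
  by rewrite -scalemxAl !dotvE; ring.
apply: is_derive_eq; rewrite /GRing.scale /=; ring.
Qed.

(** * Blocks, slices and the Kronecker product with the identity *)

Lemma big_mxtens {R : realType} m n (F : 'I_(m * n) -> R) :
  \sum_p F p = \sum_k \sum_i F (mxtens_index (k, i)).
Proof.
rewrite pair_bigA /= (reindex (@mxtens_index m n)) /=.
  by apply: eq_bigr => -[k i].
by exists (@mxtens_unindex m n) => p _; [exact: mxtens_indexK|exact: mxtens_unindexK].
Qed.

Lemma dotv_block {R : realType} m n (u v : 'rV[R]_(m * n)) :
  dotv u v = \sum_k dotv (block u k) (block v k).
Proof.
rewrite /dotv big_mxtens; apply: eq_bigr => k _; apply: eq_bigr => i _.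
by rewrite !mxE.
Qed.

Lemma blockD {R : realType} m n (u v : 'rV[R]_(m * n)) k :
  block (u + v) k = block u k + block v k.
Proof. by apply/rowP => i; rewrite !mxE. Qed.

Lemma blockZ {R : realType} m n a (u : 'rV[R]_(m * n)) k :
  block (a *: u) k = a *: block u k.
Proof. by apply/rowP => i; rewrite !mxE. Qed.

(** The inverse of taking blocks; it turns the states of all agents into one vector, so that the
    algorithm becomes a single recursion. *)
Definition stack {R : realType} {m n} (u : 'I_m -> 'rV[R]_n) : 'rV[R]_(m * n) :=
  \row_p u (mxtens_unindex p).1 0 (mxtens_unindex p).2.

Lemma stackK {R : realType} m n (u : 'I_m -> 'rV[R]_n) k : block (stack u) k = u k.
Proof. by apply/rowP => i; rewrite !mxE mxtens_indexK. Qed.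

Lemma block_inj {R : realType} m n (u v : 'rV[R]_(m * n)) :
  (forall k, block u k = block v k) -> u = v.
Proof.
move=> uv; apply/rowP => p; case: (mxtens_indexP p) => k i.
by have /rowP /(_ i) := uv k; rewrite !mxE.
Qed.

Lemma mulmx_tens1E {R : realType} m n (W : 'M[R]_m) (v : 'rV[R]_(m * n)) k i :
  (v *m (W *t (1%:M : 'M[R]_n))) 0 (mxtens_index (k, i)) =
  \sum_j v 0 (mxtens_index (j, i)) * W j k.
Proof.
rewrite mxE big_mxtens; apply: eq_bigr => j _.
rewrite (bigD1 i) //= big1 => [|l li]; rewrite tensmxE mxE.
  by rewrite eqxx mulr1 addr0.
by rewrite (negPf li) !mulr0.
Qed.

(* The i-th coordinates of all the blocks, on which [W *t 1%:M] acts as [W]. *)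
Definition slice {R : realType} {m n} (v : 'rV[R]_(m * n)) (i : 'I_n) :
    'rV[R]_m :=
  \row_k v 0 (mxtens_index (k, i)).

Lemma dotv_slice {R : realType} m n (u v : 'rV[R]_(m * n)) :
  dotv u v = \sum_i dotv (slice u i) (slice v i).
Proof.
rewrite /dotv big_mxtens exchange_big /=; apply: eq_bigr => i _.
by apply: eq_bigr => k _; rewrite !mxE.
Qed.

Lemma slice_mulmx_tens1 {R : realType} m n (W : 'M[R]_m)
    (v : 'rV[R]_(m * n)) i :
  slice (v *m (W *t (1%:M : 'M[R]_n))) i = slice v i *m W.
Proof.
apply/rowP => k; rewrite mxE mulmx_tens1E mxE.
by apply: eq_bigr => j _; rewrite mxE.
Qed.

(** * The stochastic matrix bound and the gradient of the penalized cost *)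

(** Weight [2 u_i u_j <= u_i^2 + u_j^2] by [W j i] and sum; row and column sums are 1. This makes
    the penalty positive semidefinite. *)
Lemma dotv_stochastic_le {R : realType} m (W : 'M[R]_m) :
  W^T = W -> (forall i j, 0 <= W i j) ->
  W *m const_mx 1 = const_mx 1 :> 'cV[R]_m ->
  forall u : 'rV[R]_m, dotv (u *m W) u <= dotv u u.
Proof.
move=> sW W0 W1 u.
have rowW j : \sum_i W j i = 1.
  have /colP /(_ j) := W1; rewrite !mxE => <-.
  by apply: eq_bigr => i _; rewrite mxE mulr1.
have colW i : \sum_j W j i = 1.
  by rewrite -(rowW i); apply: eq_bigr => j _; rewrite -{1}sW mxE.
pose D := \sum_i \sum_j W j i * (u 0 i ^+ 2).
have D1 : D = dotv u u.
  by apply: eq_bigr => i _; rewrite -mulr_suml colW mul1r expr2.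
have D2 : \sum_i \sum_j W j i * (u 0 j ^+ 2) = dotv u u.
  rewrite exchange_big /=; apply: eq_bigr => j _.
  by rewrite -mulr_suml rowW mul1r expr2.
suff : 2 * dotv (u *m W) u <=
    D + \sum_i \sum_j W j i * (u 0 j ^+ 2) by rewrite D1 D2; lra.
rewrite -big_split /= mulr_sumr.
apply: ler_sum => i _; rewrite mxE mulr_suml mulr_sumr -big_split /=.
apply: ler_sum => j _.
have := mulr_ge0 (W0 j i) (sqr_ge0 (u 0 i - u 0 j)); lra.
Qed.

(** Identifies the gradient in the strong convexity hypothesis with the explicit vector that drives
    the algorithm. *)
Lemma is_derive_penalized_cost {R : realType} m n (W : 'M[R]_m)
    (f : 'I_m -> 'rV[R]_n -> R) (a : R) (x v : 'rV[R]_(m * n)) :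
  W^T = W -> (forall k x, differentiable (f k) x) ->
  is_derive x v (penalized_cost W f a)
    (dotv (a *: stack (fun k => grad (f k) (block x k))
           + x *m (1%:M - W *t (1%:M : 'M[R]_n))) v).
Proof.
move=> sW df; set A := 1%:M - _.
have sA : A^T = A by rewrite /A linearB /= trmx_tens !trmx1 sW.
have dfk k : is_derive x v (fun y => f k (block y k))
    (dotv (grad (f k) (block x k)) (block v k)).
  apply/is_derive_line0.
  have -> : (fun r : R => f k (block (x + r *: v) k)) =
            (fun r : R => f k (block x k + r *: block v k)).
    by apply/funext => r; rewrite blockD blockZ.
  apply/is_derive_line0; rewrite -derive_dotv_grad //.
  by apply: derivableP; apply: diff_derivable.
have dq := is_derive_quadratic A x v sA.
have -> : penalized_cost W f a = a *: (\sum_k (fun y => f k (block y k)))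
     + 2^-1 *: (fun y => dotv (y *m A) y).
  apply/funext => y; rewrite /penalized_cost -/A -dotv_mulmx.
  by rewrite [RHS]/= /GRing.scale /= fct_sumE.
have dc := is_deriveD (is_deriveZ a (is_derive_sum dfk)) (is_deriveZ 2^-1 dq).
apply: (is_derive_eq dc); rewrite /GRing.scale /= dotvDl dotvZl.
rewrite (dotv_block _ _ (stack _)) mulrA mulVf ?pnatr_eq0 // mul1r.
by congr (_ * _ + _); apply: eq_bigr => k _; rewrite stackK.
Qed.

(** * Boundedness of decentralized gradient descent *)

Theorem theorem1p6 (R : realType) (m n : nat)
    (E : rel 'I_m) (hE : connected_graph E)
    (W : 'M[R]_m) (hW : mixing_matrix E W)
    (lam_m : R) (hlam : smallest_eigenvalue W lam_m)
    (f : 'I_m -> 'rV[R]_n -> R)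
    (hf : forall k, continuously_differentiable (f k))
    (L : R) (hL : 0 < L) (hfL : forall k, smooth L (f k))
    (alpha0 : R) (halpha0 : 0 < alpha0)
    (hG : strongly_convex (penalized_cost W f alpha0))
    (alpha : nat -> R)
    (halpha_pos : forall t, 0 < alpha t)
    (halpha_noninc : nonincreasing_seq alpha)
    (halpha_le : alpha 0%N <= Num.min ((1 + lam_m) / L) alpha0)
    (x : nat -> 'I_m -> 'rV[R]_n)
    (hx : decentralized_gradient_descent W f alpha x) :
  exists2 B : R, 0 < B & forall t k, enorm (x t k) <= B.
Proof.
case: hW => sW W0 _ _ W1 _.
have df k u : differentiable (f k) u by have [] := hfL k.
pose A : 'M[R]_(m * n) := 1%:M - W *t (1%:M : 'M[R]_n).
have sA : A^T = A by rewrite /A linearB /= trmx_tens !trmx1 sW.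
have qA (v : 'rV[R]_(m * n)) :
    dotv (v *m A) v = dotv v v - dotv (v *m (W *t (1%:M : 'M[R]_n))) v.
  by rewrite mulmxBr mulmx1 !dotvE.
(* Both bounds on the penalty reduce to bounds on [W], slice by slice. *)
have psdA (v : 'rV[R]_(m * n)) : 0 <= dotv (v *m A) v.
  rewrite qA subr_ge0 !dotv_slice; apply: ler_sum => i _.
  by rewrite slice_mulmx_tens1; exact: dotv_stochastic_le.
have ubA (v : 'rV[R]_(m * n)) : dotv (v *m A) v <= (1 - lam_m) * dotv v v.
  rewrite qA mulrBl mul1r lerB //.
  rewrite !dotv_slice mulr_sumr; apply: ler_sum => i _.
  by rewrite slice_mulmx_tens1; apply: rayleigh_ge => //; exact: hlam.2.
pose F (y : 'rV[R]_(m * n)) := \sum_k f k (block y k).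
pose gF (y : 'rV[R]_(m * n)) := stack (fun k => grad (f k) (block y k)).
have blockB (y z : 'rV[R]_(m * n)) k : block (z - y) k = block z k - block y k.
  by rewrite -scaleN1r blockD blockZ scaleN1r.
have upF y z : F z <= F y + dotv (gF y) (z - y) + L / 2 * dotv (z - y) (z - y).
  rewrite !dotv_block mulr_sumr -!big_split /=; apply: ler_sum => k _.
  by rewrite stackK blockB; exact: smooth_upper.
have [mu mu0 [dG sG]] := hG.
have costE y : penalized_cost W f alpha0 y =
    alpha0 * F y + 2^-1 * dotv (y *m A) y.
  by rewrite dotv_mulmx.
have sconv y z : alpha0 * F y + 2^-1 * dotv (y *m A) y
    + dotv (alpha0 *: gF y + y *m A) (z - y) + mu / 2 * dotv (z - y) (z - y)
    <= alpha0 * F z + 2^-1 * dotv (z *m A) z.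
  have := sG y z; rewrite enorm_sqr !costE -derive_dotv_grad //.
  by have [_ ->] := is_derive_penalized_cost m n W f alpha0 y (z - y) sW df.
move: halpha_le; rewrite le_min => /andP[aL a0].
(* The identity part of [A] cancels [stack (x t)], leaving the mixing term; symmetry of [W] matches
   right multiplication by [W] with the row weights [W k j]. *)
have xS t : stack (x t.+1) =
    stack (x t) - (alpha t *: gF (stack (x t)) + stack (x t) *m A).
  apply: block_inj => k; rewrite blockB blockD blockZ !stackK hx.
  rewrite mulmxBr mulmx1 blockB stackK opprD opprB addrCA [x t k + _]addrC subrK addrC.
  congr (_ - _); apply/rowP => i; rewrite mxE mulmx_tens1E summxE.
  by apply: eq_bigr => j _; rewrite !mxE mxtens_indexK -{1}sW mxE mulrC.
have [B B0 xB] := bounded_penalized_descent _ _ F gF A L lam_m mu alpha0 sA psdA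
  ubA upF hL mu0 halpha0 sconv alpha (fun t => stack (x t)) halpha_pos
  halpha_noninc a0 aL xS.
exists B => // t k; apply: le_trans (xB t).
(* The squared norm of one block is a summand of the squared norm of the stacked vector. *)
rewrite ler_wsqrtr // [leRHS]dotv_block (bigD1 k) //= stackK lerDl.
by apply: sumr_ge0 => j _; exact: dotvv_ge0.
Qed.
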